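(* There exists a family of quantum circuits, one for each $n\ge 1$, of depth $O(1)$ (a constant independent of $n$) and size $O(n\log n)$, such that the $n$-th circuit implements exactly the quantum operation $\mathrm{OR}_n$.
   Context: Quantum circuits are built from elementary gates: arbitrary one-qubit gates, CNOT gates, and unbounded fan-out gates. An unbounded fan-out gate on $k+1$ qubits ($k\ge1$) maps $|y\rangle\bigotimes_{j=0}^{k-1}|x_j\rangle \mapsto |y\rangle\bigotimes_{j=0}^{k-1}|x_j\oplus y\rangle$ for $y,x_j\in\{0,1\}$ (for $k=1$ it is a CNOT). Circuits may use ancillary qubits initialized to $|0\rangle$. The size of a circuit is the total over its gates of the number of qubits each gate acts on; the depth is the number of layers, defined by: input qubits have depth 0, a gate has depth 1 plus the maximal depth of gates it depends on, and the circuit depth is the maximal gate depth. For $x=x_0\cdots x_{n-1}\in\{0,1\}^n$, $\mathrm{OR}_n(x)=1$ if $x\ne 0^n$ and $0$ otherwise; the quantum operation $\mathrm{OR}_n$ maps $\bigl(\bigotimes_{j=0}^{n-1}|x_j\rangle\bigr)|z\rangle\mapsto\bigl(\bigotimes_{j=0}^{n-1}|x_j\rangle\bigr)|z\oplus \mathrm{OR}_n(x)\rangle$ for $x_j,z\in\{0,1\}$. Logarithms are base 2. *)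

(* Defs.v *)
From mathcomp Require Import all_boot all_order all_algebra.
From mathcomp Require Import complex.
From mathcomp Require Import reals Rstruct exp.
Set Implicit Arguments. Unset Strict Implicit. Unset Printing Implicit Defensive.
Import GRing.Theory Num.Theory.
Local Open Scope ring_scope.

Definition RR : realType := Rdefinitions.R.
Definition CC : numClosedFieldType := RR[i].

Definition log2 (x : RR) : RR := ln x / ln 2.

Definition basis (N : nat) := {ffun 'I_N -> bool}.
Definition qstate (N : nat) := basis N -> CC.

Definition ket (N : nat) (b : basis N) : qstate N := fun b' => (b' == b)%:R.

Definition b2o (a : bool) : 'I_2 := if a then ord_max else ord0.

Definition upd (N : nat) (b : basis N) (q : 'I_N) (a : bool) : basis N :=
  [ffun j => if j == q then a else b j].

(* Elementary gates on N wires: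
   - G1 q U : arbitrary one-qubit gate U (2x2 matrix, required unitary) on wire q;
   - GFan c ts : unbounded fan-out with control c and targets ts (k = size ts >= 1);
     for k = 1 this is exactly a CNOT gate. *)
Inductive gate (N : nat) :=
  | G1 of 'I_N & 'M[CC]_2
  | GFan of 'I_N & seq 'I_N.

Definition circuit (N : nat) := seq (gate N).

Definition gate_wf (N : nat) (g : gate N) : bool :=
  match g with
  | G1 _ U => U \is unitarymx
  | GFan c ts => [&& ts != [::], uniq ts & c \notin ts]
  end.

Definition circuit_wf (N : nat) (C : circuit N) : bool := all (@gate_wf N) C.

Definition wires (N : nat) (g : gate N) : seq 'I_N :=
  match g with
  | G1 q _ => [:: q]
  | GFan c ts => c :: ts
  end.

(* Action of a gate on a state: |a> on wire q is mapped to sum_b U_{b,a} |b>;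
   fan-out maps |y>|x_j> to |y>|x_j xor y>. *)
Definition apply_gate (N : nat) (g : gate N) (psi : qstate N) : qstate N :=
  match g with
  | G1 q U => fun b => \sum_(a : bool) U (b2o (b q)) (b2o a) * psi (upd b q a)
  | GFan c ts => fun b => psi [ffun j => if j \in ts then b j (+) b c else b j]
  end.

Definition run (N : nat) (C : circuit N) (psi : qstate N) : qstate N :=
  foldl (fun s g => apply_gate g s) psi C.

Definition csize (N : nat) (C : circuit N) : nat :=
  \sum_(g <- C) size (wires g).

(* Depth: each wire records the depth of the last gate on it (0 initially =
   input depth); a gate gets 1 + max of these over its wires; the circuit
   depth is the max gate depth (0 for the empty circuit). *)
Definition depth_step (N : nat) (st : {ffun 'I_N -> nat} * nat) (g : gate N)
  : {ffun 'I_N -> nat} * nat :=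
  let k := (\max_(i <- wires g) st.1 i).+1 in
  ([ffun i => if i \in wires g then k else st.1 i], maxn st.2 k).

Definition cdepth (N : nat) (C : circuit N) : nat :=
  (foldl (@depth_step N) ([ffun => 0%N], 0%N) C).2.

(* Wire layout on n + 1 + m qubits: wires 0..n-1 hold x, wire n holds z,
   wires n+1 .. n+m are ancillas (initialised to |0>). *)
Definition enc (n m : nat) (x : n.-tuple bool) (z : bool) : basis (n + 1 + m) :=
  [ffun j : 'I_(n + 1 + m) =>
     if (j < n)%N then nth false x j else if (j == n :> nat) then z else false].

Definition ORn (n : nat) (x : n.-tuple bool) : bool := has id x.

Definition implements_OR (n m : nat) (C : circuit (n + 1 + m)) : Prop :=
  forall (x : n.-tuple bool) (z : bool),
    run C (ket (enc m x z)) = ket (enc m x (z (+) ORn x)).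

(* Main.v *)
Require Import Defs.
From mathcomp Require Import all_boot all_order all_algebra.
From mathcomp Require Import complex.
From mathcomp Require Import reals Rstruct exp.
From mathcomp Require Import boolp.
From mathcomp Require Import zify ring.
Set Implicit Arguments. Unset Strict Implicit. Unset Printing Implicit Defensive.
Import GRing.Theory Num.Theory.
Local Open Scope ring_scope.

(* The phases rt k = exp(i pi / 2^k) drive a two-step reduction. First, if the
   weight |x| is nonzero, then rt k ^ |x| = -1 for k the 2-adic valuation of
   |x|; hence M > log2 n wires y_k, put in the state with amplitude
   (1 + (-1)^s rt k ^ |x|) / 2 on |s>, are all 0 when x = 0 and never all 0 when
   x <> 0, so OR(y) = OR(x) in every branch of the superposition.
   Second, OR(y) is computed from the 2^M parities t_a = a.y, a in {0,1}^M:
   exactly 2^(M-1) of them are 1 if y <> 0 and none otherwise, so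
   rt (M-1) ^ (sum_a t_a) = (-1)^OR(y), a phase which flips z between two
   Hadamard gates.
   Each of the steps x -> y -> t -> z has the form H_A D H_A with D a product of
   controlled phases between the wires of A and those of a second set B, and
   such a D has constant depth given one ancilla per pair in A x B. The steps
   x -> y and y -> t are finally undone. *)

(** * One-qubit gates: Hadamard and phase *)

Definition hadamard : 'M[CC]_2 :=
  \matrix_(i, j) ((-1) ^+ (i * j) / sqrtC 2).

Definition phase (p : CC) : 'M[CC]_2 := diag_mx (\row_i p ^+ i).

Lemma hadamardE (s a : bool) :
  hadamard (b2o s) (b2o a) = (-1) ^+ (s * a) / sqrtC 2.
Proof. by rewrite mxE; case: s; case: a. Qed.

Lemma hadamard_unitary : hadamard \is unitarymx.
Proof.
have r : (sqrtC 2 : CC)^* = sqrtC 2 by apply/CrealP/ger0_real; rewrite sqrtC_ge0 ler0n.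
have nz : (sqrtC 2 : CC) != 0 by rewrite sqrtC_eq0 pnatr_eq0.
apply/unitarymxP/matrixP => i j.
rewrite !mxE !big_ord_recl big_ord0 !mxE /= !fmorph_div !rmorphXn !rmorphN1 /= r.
have e : sqrtC 2 ^+ 2 = 2 :> CC by rewrite sqrtCK.
by case: i => [[|[|//]] hi]; case: j => [[|[|//]] hj] /=;
  rewrite ?expr0 ?expr1 ?muln0 ?muln1; field : e.
Qed.

Lemma phaseE (p : CC) (s a : bool) :
  phase p (b2o s) (b2o a) = (s == a)%:R * p ^+ a.
Proof. by rewrite !mxE; case: s; case: a; rewrite /= ?mulr1n ?mulr0n ?mul1r ?mul0r. Qed.

Lemma phase_unitary (p : CC) : `|p| = 1 -> phase p \is unitarymx.
Proof.
move=> p1; apply/unitarymxP/matrixP => i j.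
have e : p * p^* = 1 by rewrite -normCK p1 expr1n.
rewrite !mxE !big_ord_recl big_ord0 !mxE /=.
by case: i => [[|[|//]] hi]; case: j => [[|[|//]] hj] /=;
  rewrite ?mulr1n ?mulr0n ?mul0r ?rmorph0 ?mulr0 ?addr0 ?add0r ?expr0 ?rmorph1 ?mulr1 ?expr1 ?e.
Qed.

(** * Action of gate lists on basis states *)

Section States.
Variable N : nat.
Implicit Types (b r : basis N) (w q : 'I_N) (C : circuit N) (psi : qstate N).

Lemma ket_prod b r : ket b r = \prod_w (r w == b w)%:R.
Proof.
rewrite /ket; case: eqP => [->|nrb].
  by rewrite big1 // => w _; rewrite eqxx.
have [w nw|h] := pickP (fun w => r w != b w).
  by rewrite (bigD1 w) //= (negPf nw) mul0r.
by case: nrb; apply/ffunP => w; apply/eqP; rewrite -[_ == _]negbK h.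
Qed.

Lemma ket_expand psi : psi = fun b => \sum_r psi r * ket r b.
Proof.
apply: funext => b; rewrite (bigD1 b) //= /ket eqxx mulr1 big1 ?addr0 // => r.
by rewrite eq_sym => /negPf ->; rewrite mulr0.
Qed.

Lemma run_cat C1 C2 psi : run (C1 ++ C2) psi = run C2 (run C1 psi).
Proof. exact: foldl_cat. Qed.

Lemma run_cons g C psi : run (g :: C) psi = run C (apply_gate g psi).
Proof. by []. Qed.

Lemma run_lin C (I : finType) (c : I -> CC) (s : I -> qstate N) :
  run C (fun b => \sum_i c i * s i b) = fun b => \sum_i c i * run C (s i) b.
Proof.
elim: C s => [//|g C IH] s; rewrite run_cons.
suff -> : apply_gate g (fun b => \sum_i c i * s i b) =
          fun b => \sum_i c i * apply_gate g (s i) b by exact: IH.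
apply: funext => b; case: g => [q U|a ts] //=.
under eq_bigr => a _ do rewrite mulr_sumr.
rewrite exchange_big; apply: eq_bigr => i _.
by rewrite mulr_sumr; apply: eq_bigr => a _; ring.
Qed.

Lemma run_ketE C psi : run C psi = fun b => \sum_r psi r * run C (ket r) b.
Proof. by rewrite {1}(ket_expand psi) run_lin. Qed.

Lemma run_scale C c psi : run C (fun b => c * psi b) = fun b => c * run C psi b.
Proof.
rewrite run_ketE [in RHS]run_ketE; apply: funext => b; rewrite mulr_sumr.
by apply: eq_bigr => r _; rewrite mulrA.
Qed.

(** Gates on distinct wires act on distinct tensor factors, so the amplitude is a product over
    wires. *)
Lemma run_layer1 (U : 'M[CC]_2) (l : seq 'I_N) b : uniq l ->
  run [seq G1 q U | q <- l] (ket b) = fun r =>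
    \prod_w (if w \in l then U (b2o (r w)) (b2o (b w)) else (r w == b w)%:R).
Proof.
elim/last_ind: l => [|l q IH].
  by move=> _; apply: funext => r /=; rewrite ket_prod.
rewrite rcons_uniq => /andP[ql ul]; rewrite map_rcons -cats1 run_cat IH //.
apply: funext => r /=.
(* Before the last gate, wire [q] still carries its initial bit, so only [a = b q] contributes. *)
rewrite (bigD1 (b q)) //= [X in _ + X]big1 ?addr0 => [|a na]; last first.
  by rewrite (bigD1 q) //= (negPf ql) ffunE eqxx (negPf na) mul0r mulr0.
rewrite (bigD1 q) //= (negPf ql) ffunE eqxx eqxx mul1r.
rewrite [RHS](bigD1 q) //= mem_rcons in_cons eqxx; congr (_ * _).
by apply: eq_bigr => w nw; rewrite ffunE (negPf nw) mem_rcons in_cons (negPf nw).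
Qed.

(** Phase gates are diagonal: they only accumulate scalars, even if wires repeat in the list. *)
Lemma run_phases (J : Type) (l : seq J) (q : J -> 'I_N) (f : J -> CC) b :
  run [seq G1 (q j) (phase (f j)) | j <- l] (ket b) =
  fun r => (\prod_(j <- l) f j ^+ b (q j)) * ket b r.
Proof.
elim: l => [|j l IH].
  by apply: funext => r; rewrite big_nil mul1r.
rewrite map_cons run_cons.
have -> : apply_gate (G1 (q j) (phase (f j))) (ket b) = fun r => f j ^+ b (q j) * ket b r.
  apply: funext => r; rewrite /= (bigD1 (r (q j))) //= [X in _ + X]big1 ?addr0 => [|a na]; last first.
    by rewrite phaseE eq_sym (negPf na) !mul0r.
  have -> : upd r (q j) (r (q j)) = r by apply/ffunP => w; rewrite ffunE; case: eqP => [->|].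
  rewrite phaseE eqxx mul1r /ket; case: eqP => [->//|_]; by rewrite !mulr0.
by rewrite run_scale IH; apply: funext => r; rewrite big_cons mulrA.
Qed.

Definition fans (c : seq 'I_N) (T : 'I_N -> seq 'I_N) : circuit N :=
  [seq GFan a (T a) | a <- c].

(** All controls are read in the initial state [b]; this agrees with the sequential run once no
    control is a target. *)
Definition fan_basis (c : seq 'I_N) (T : 'I_N -> seq 'I_N) b : basis N :=
  [ffun w => b w (+) \big[addb/false]_(a <- c) (b a && (w \in T a))].

Lemma fan_basis_out c T b w :
  {in c, forall a, w \notin T a} -> fan_basis c T b w = b w.
Proof.
move=> h; rewrite ffunE big_seq big1 ?addbF // => a ac.
by rewrite (negPf (h a ac)) andbF.
Qed.

Lemma fan_basisK c T b : {in c &, forall a a', a \notin T a'} ->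
  fan_basis c T (fan_basis c T b) = b.
Proof.
move=> h; apply/ffunP => w; rewrite ffunE [fan_basis _ _ _ w]ffunE -addbA.
rewrite [X in _ (+) (_ (+) X)](_ : _ = \big[addb/false]_(a <- c) (b a && (w \in T a))).
  by rewrite addbb addbF.
rewrite [LHS]big_seq [RHS]big_seq; apply: eq_bigr => a ac.
by rewrite fan_basis_out // => a' ac'; exact: h.
Qed.

Lemma run_fans c T b : {in c &, forall a a', a \notin T a'} ->
  run (fans c T) (ket b) = ket (fan_basis c T b).
Proof.
elim: c b => [|a c IH] b h.
  by rewrite /run /=; congr ket; apply/ffunP => w; rewrite ffunE big_nil addbF.
rewrite /fans map_cons run_cons -/(fans c T).
have aT : a \notin T a by apply: h; rewrite mem_head.
have -> : apply_gate (GFan a (T a)) (ket b) = ket (fan_basis [:: a] T b).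
  have E r : [ffun j => if j \in T a then r j (+) r a else r j] = fan_basis [:: a] T r.
    by apply/ffunP => w; rewrite !ffunE big_seq1; case: (w \in T a); rewrite ?andbT ?andbF ?addbF.
  (* The gate precomposes the state with a bit map; as this map is its own inverse, a ket goes to
     the ket of the image. *)
  have K r : fan_basis [:: a] T (fan_basis [:: a] T r) = r.
    by apply: fan_basisK => x y; rewrite !inE => /eqP -> /eqP ->.
  apply: funext => r /=; rewrite E /ket.
  by congr (nat_of_bool _)%:R; apply/idP/idP => /eqP; [move=> <-|move=> ->]; rewrite K.
rewrite IH => [|x y xc yc]; last by apply: h; rewrite in_cons ?xc ?yc orbT.
congr ket; apply/ffunP => w; rewrite !ffunE !big_cons big_nil addbF -addbA.
congr (_ (+) (_ (+) _)); rewrite [LHS]big_seq [RHS]big_seq; apply: eq_bigr => x xc.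
rewrite fan_basis_out // => y; rewrite inE => /eqP ->.
by apply: h; rewrite ?mem_head // in_cons xc orbT.
Qed.

End States.

(** * Layers of gates on disjoint wires, and depth *)

Definition layer (N : nat) (C : circuit N) :=
  uniq (flatten [seq wires g | g <- C]).

Section Layers.
Variable N : nat.
Implicit Types C : circuit N.

Lemma csize_cat C1 C2 : csize (C1 ++ C2) = (csize C1 + csize C2)%N.
Proof. by rewrite /csize big_cat. Qed.

Lemma layer_fans (c : seq 'I_N) (T : 'I_N -> seq 'I_N) :
  uniq c -> {in c, forall a, uniq (T a)} ->
  {in c &, forall a a', a \notin T a'} ->
  {in c &, forall a a' w, w \in T a -> w \in T a' -> a = a'} ->
  layer (fans c T).
Proof.
rewrite /layer; elim: c => [//|a c IH] /andP[ac uc] uT ctrl tgt.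
have sub x : x \in c -> x \in a :: c by move=> xc; rewrite in_cons xc orbT.
rewrite /= cat_uniq uT ?mem_head // IH //; first last.
- by move=> x y xc yc; apply: tgt; exact: sub.
- by move=> x y xc yc; apply: ctrl; exact: sub.
- by move=> x xc; apply: uT; exact: sub.
have mem w : w \in flatten [seq wires g | g <- fans c T] ->
    exists2 x, x \in c & (w == x) || (w \in T x).
  by rewrite /fans -map_comp => /flattenP[_ /mapP[x xc ->] wx]; exists x; rewrite // -in_cons.
rewrite mem_cat negb_or ctrl ?mem_head //= andbT; apply/andP; split.
  apply/negP => /mem[x xc /orP[/eqP e|aT]]; first by rewrite e xc in ac.
  by move: aT; apply/negP; apply: ctrl; rewrite ?mem_head ?sub.
apply/hasPn => w /mem[x xc /orP[/eqP ->|wT]].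
  by apply: ctrl; rewrite ?mem_head ?sub.
apply/negP => wT'; have e := tgt a x (mem_head _ _) (sub _ xc) w wT' wT.
by rewrite e xc in ac.
Qed.

Lemma depth_layer C (st : {ffun 'I_N -> nat} * nat) (K : nat) : layer C ->
  (forall i, st.1 i <= K)%N -> (st.2 <= K)%N ->
  (forall i, (foldl (@depth_step N) st C).1 i <= K.+1)%N /\
  ((foldl (@depth_step N) st C).2 <= K.+1)%N.
Proof.
move=> lC h1 h2.
(* The induction carries two bounds: [K] on the wires that the remaining gates touch, [K.+1] on all
   wires. *)
have : {in flatten [seq wires g | g <- C], forall i, st.1 i <= K}%N by [].
have {h1} : (forall i, st.1 i <= K.+1)%N by move=> i; exact: leqW.
have {h2} : (st.2 <= K.+1)%N by exact: leqW.
elim: C st lC => [//|g C IH] st; rewrite /layer /= cat_uniq => /and3P[_ dis uC] h2 h1 hw.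
have k1 : (\max_(i <- wires g) st.1 i <= K)%N.
  by apply/bigmax_leqP_seq => i ig _; apply: hw; rewrite mem_cat ig.
apply: IH => //= [|i|i iC].
- by rewrite geq_max h2.
- by rewrite ffunE; case: ifP.
- rewrite ffunE (negPf (hasPn dis i iC)); apply: hw; by rewrite mem_cat iC orbT.
Qed.

Lemma depth_layers (Ls : seq (circuit N)) :
  all (@layer _) Ls -> (cdepth (flatten Ls) <= size Ls)%N.
Proof.
move=> lL; rewrite /cdepth -[size Ls]add0n; move: lL.
set st := (_, 0%N); have : (st.2 <= 0)%N by [].
have : (forall i, st.1 i <= 0)%N by move=> i; rewrite ffunE.
move: st 0%N; elim: Ls => [|L Ls IH] st K h1 h2 /=; first by rewrite addn0.
move=> /andP[lL lLs]; rewrite foldl_cat -addSnnS.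
have [h1' h2'] := depth_layer lL h1 h2; exact: IH.
Qed.

End Layers.

(** * The block H_A D H_A, its action, inverse, size and layers *)

Section Block.
(** [P] marks the working wires; [anc a v] is an ancilla private to the pair, so that all pairs are
    treated in parallel. *)
Variables (N : nat) (P : pred 'I_N) (anc : 'I_N -> 'I_N -> 'I_N).
Hypothesis anc_inj : forall a v a' v', P a -> P v -> P a' -> P v' ->
  anc a v = anc a' v' -> a = a' /\ v = v'.
Hypothesis ancP : forall a v, P a -> P v -> ~~ P (anc a v).
Implicit Types (b r : basis N) (w q a v : 'I_N) (lam : 'I_N -> 'I_N -> CC).
Implicit Types A B : seq 'I_N.

Definition fanA A B := fans A (fun a => [seq anc a v | v <- B]).
Definition fanB A B := fans B (fun v => [seq anc a v | a <- A]).

(* Since 2xy = x + y - (x (+) y), a controlled phase with angle t is a phase t/2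
   on each of the two wires and a phase -t/2 on an ancilla holding their sum. *)
Definition cphases lam A B : seq (circuit N) :=
  [:: fanA A B; fanB A B;
      [seq G1 (anc p.1 p.2) (phase (sqrtC (lam p.1 p.2))^-1)
         | p <- allpairs pair A B];
      [seq G1 a (phase (\prod_(v <- B) sqrtC (lam a v))) | a <- A];
      [seq G1 v (phase (\prod_(a <- A) sqrtC (lam a v))) | v <- B];
      fanB A B; fanA A B].

Definition block lam A B : seq (circuit N) :=
  [seq G1 a hadamard | a <- A] ::
  rcons (cphases lam A B) [seq G1 a hadamard | a <- A].

Definition clean b := forall w, ~~ P w -> b w = false.

(** The phase that D puts on the value 1 of wire [w] when the wires of [B] carry [b]. *)
Definition bigphase lam B b w : CC := \prod_(v <- B) lam w v ^+ b v.

(** Once the bits of [B] are fixed, D is diag(1, p) on each wire of [A], and H diag(1, p) H has the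
    entries (1 + (-1)^(b + r) p) / 2. *)
Definition amp lam A B b : qstate N := fun r =>
  \prod_w (if w \in A then (1 + (-1) ^+ (b w + r w) * bigphase lam B b w) / 2
           else (r w == b w)%:R).

Lemma block_size lam A B :
  csize (flatten (block lam A B)) = (5 * size A * size B + 5 * size A + 3 * size B)%N.
Proof.
have c1 (J : Type) (l : seq J) (q : J -> 'I_N) (U : J -> 'M[CC]_2) :
    csize [seq G1 (q j) (U j) | j <- l] = size l.
  by rewrite /csize big_map sum1_size.
have cA : csize (fanA A B) = (size A * (size B).+1)%N.
  rewrite /csize big_map /=; under eq_bigr => a _ do rewrite size_map.
  by rewrite big_const_seq count_predT iter_addn_0 mulnC.
have cB : csize (fanB A B) = (size B * (size A).+1)%N.
  rewrite /csize big_map /=; under eq_bigr => a _ do rewrite size_map.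
  by rewrite big_const_seq count_predT iter_addn_0 mulnC.
rewrite /= cats0 !csize_cat cA cB !c1 size_allpairs; lia.
Qed.

Variables A B : seq 'I_N.
Hypotheses (uA : uniq A) (uB : uniq B).
Hypotheses (AP : {in A, forall w, P w}) (BP : {in B, forall w, P w}).
Hypothesis disj : {in A, forall w, w \notin B}.

Lemma fanA_ctrl w w' : P w -> w' \in A -> w \notin [seq anc w' v | v <- B].
Proof.
move=> pw wA; apply/mapP => -[v vB e].
by have := ancP (AP wA) (BP vB); rewrite -e pw.
Qed.

Lemma fanB_ctrl w w' : P w -> w' \in B -> w \notin [seq anc a w' | a <- A].
Proof.
move=> pw wB; apply/mapP => -[a aA e].
by have := ancP (AP aA) (BP wB); rewrite -e pw.
Qed.

Let FA := fan_basis A (fun a => [seq anc a v | v <- B]).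
Let FB := fan_basis B (fun v => [seq anc a v | a <- A]).

Let ctrlA : {in A &, forall a a', a \notin [seq anc a' v | v <- B]}.
Proof. by move=> a a' aA a'A; apply: fanA_ctrl => //; exact: AP. Qed.

Let ctrlB : {in B &, forall v v', v \notin [seq anc a v' | a <- A]}.
Proof. by move=> a a' aA a'A; apply: fanB_ctrl => //; exact: BP. Qed.

Lemma fanAB_prim b w : P w -> FB (FA b) w = b w.
Proof.
move=> pw; rewrite /FB /FA !fan_basis_out // => w' w'B.
  exact: fanA_ctrl.
exact: fanB_ctrl.
Qed.

(** The ancilla starts at 0 and, [anc] being injective, is a target of exactly one control in [A]
    and one in [B]. *)
Lemma fanAB_anc b a v : clean b -> a \in A -> v \in B ->
  FB (FA b) (anc a v) = b a (+) b v.
Proof.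
move=> cb aA vB; rewrite ffunE ffunE cb ?addFb; last by apply: ancP; [exact: AP|exact: BP].
congr (_ (+) _).
  rewrite (bigD1_seq a) //= map_f // andbT big_seq_cond big1 ?addbF // => a' /andP[a'A na].
  case: mapP => [[v' v'B]|]; last by rewrite andbF.
  by case/(anc_inj (AP aA) (BP vB) (AP a'A) (BP v'B)) => e; rewrite e eqxx in na.
rewrite (bigD1_seq v) //= map_f // andbT big_seq_cond big1 ?addbF.
  by apply: fan_basis_out => w wA; apply: fanA_ctrl => //; exact: BP.
move=> v' /andP[v'B nv].
case: mapP => [[a' a'A]|]; last by rewrite andbF.
by case/(anc_inj (AP aA) (BP vB) (AP a'A) (BP v'B)) => _ e; rewrite e eqxx in nv.
Qed.

(** The second pair of fan-out layers undoes the first, leaving only scalars; on a pair with bits x,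
    y the square roots combine to [lam] to the power x y. *)
Lemma run_cphases lam b : clean b ->
  (forall a v, lam a v != 0) ->
  run (flatten (cphases lam A B)) (ket b) =
  fun r => (\prod_(a <- A) bigphase lam B b a ^+ b a) * ket b r.
Proof.
move=> cb l0; rewrite /= cats0 !run_cat !run_fans // -/FA -/FB.
do 3 rewrite run_phases ?run_scale.
rewrite !run_fans // !fan_basisK //.
apply: funext => r; rewrite !mulrA; congr (_ * _).
rewrite big_allpairs /= [X in _ * X]big_seq.
under [X in _ * X]eq_bigr => v vB do
  rewrite fanAB_prim ?BP // -prodrXl.
rewrite -big_seq [X in _ * X]exchange_big /= -!big_split /= big_seq [RHS]big_seq.
apply: eq_bigr => a aA; rewrite fanAB_prim ?AP // -!prodrXl -!big_split /=.
rewrite big_seq [RHS]big_seq; apply: eq_bigr => v vB.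
rewrite fanAB_anc //.
have e : sqrtC (lam a v) ^+ 2 = lam a v by rewrite sqrtCK.
have nz : sqrtC (lam a v) != 0 by rewrite sqrtC_eq0.
case: (b a); case: (b v); rewrite /= ?expr0 ?expr1 ?mul1r ?mulr1 ?mulVf //.
Qed.

Lemma amp_supp lam b r w : w \notin A -> amp lam A B b r != 0 -> r w = b w.
Proof.
move=> wA; rewrite /amp (bigD1 w) //= (negPf wA).
by case: (r w =P b w) => // _; rewrite /= mul0r eqxx.
Qed.

Lemma amp_clean lam b r : clean b -> amp lam A B b r != 0 -> clean r.
Proof.
move=> cb nz w nw; rewrite (amp_supp _ nz) ?cb //.
by apply: contra nw; exact: AP.
Qed.

Lemma bigphase_amp lam b r w : amp lam A B b r != 0 ->
  bigphase lam B r w = bigphase lam B b w.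
Proof.
move=> nz; rewrite /bigphase big_seq [RHS]big_seq; apply: eq_bigr => v vB.
rewrite (amp_supp _ nz) //; apply/negP => /disj; by rewrite vB.
Qed.

Lemma run_block lam b : clean b -> (forall a v, lam a v != 0) ->
  run (flatten (block lam A B)) (ket b) = amp lam A B b.
Proof.
move=> cb l0; set H := [seq G1 a hadamard | a <- A].
have -> : flatten (block lam A B) = H ++ flatten (cphases lam A B) ++ H.
  by rewrite /block; move: (cphases _ _ _) => D; rewrite -cats1 /= flatten_cat /= cats0.
rewrite run_cat run_cat run_layer1 //.
rewrite [run (flatten _) _]run_ketE [LHS]run_lin; apply: funext => r.
(* Here [x] is the bit of wire [w] between the two Hadamard layers, which the diagonal D preserves.
   Expanding the product of the sums over [x] gives the sum over intermediate basis states. *)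
pose F w (x : bool) : CC := if w \in A then
    hadamard (b2o x) (b2o (b w)) * bigphase lam B b w ^+ x * hadamard (b2o (r w)) (b2o x)
  else (x == b w)%:R * (r w == x)%:R.
transitivity (\prod_w \sum_x F w x); last first.
  apply: eq_bigr => w _; rewrite big_bool /F; case: (w \in A).
    have nz : (sqrtC 2 : CC) != 0 by rewrite sqrtC_eq0 pnatr_eq0.
    have e : sqrtC 2 ^+ 2 = 2 :> CC by rewrite sqrtCK.
    by rewrite !hadamardE; case: (b w); case: (r w); rewrite /= ?expr0 ?expr1 ?expr2; field : e.
  by case: (b w); case: (r w); rewrite /= ?mulr0 ?mul0r ?mulr1 ?addr0 ?add0r.
rewrite bigA_distr_bigA; apply: eq_bigr => s _.
set c := (X in X * _ = _); set c' := \prod_w (if w \in A then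
  bigphase lam B b w ^+ s w * hadamard (b2o (r w)) (b2o (s w)) else (r w == s w)%:R).
have -> : \prod_i F i (s i) = c * c'.
  by rewrite -big_split; apply: eq_bigr => w _; rewrite /F /=; case: ifP => // _; rewrite mulrA.
(* An intermediate state of nonzero amplitude agrees with [b] off [A], hence is clean and sees the
   same phases. *)
have [->|nz] := eqVneq c 0; first by rewrite !mul0r.
congr (_ * _); have out w : w \notin A -> s w = b w.
  move=> wA; apply/eqP; apply: contraR nz => ns.
  by rewrite /c (bigD1 w) //= (negPf wA) (negPf ns) mul0r.
have cs : clean s.
  by move=> w nw; rewrite out ?cb //; apply: contra nw; exact: AP.
rewrite run_cphases // run_scale run_layer1 // big_uniq // big_mkcond -big_split.
apply: eq_bigr => w _ /=; case: ifP => wA; last by rewrite mul1r.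
congr (_ ^+ _ * _); rewrite /bigphase big_seq [RHS]big_seq; apply: eq_bigr => v vB.
by rewrite out //; apply/negP => /disj; rewrite vB.
Qed.

(** Inverting p inverts each factor H diag(1, p) H, and [B] has the same bits in every branch, so
    the inversion works wire by wire. *)
Lemma run_blockV lam b : clean b -> (forall a v, lam a v != 0) ->
  run (flatten (block (fun a v => (lam a v)^-1) A B)) (amp lam A B b) = ket b.
Proof.
move=> cb l0; rewrite run_ketE; apply: funext => r; rewrite ket_prod.
pose f (w : 'I_N) (x y : bool) : CC := (1 + (-1) ^+ (x + y) * bigphase lam B b w) / 2.
pose g (w : 'I_N) (x y : bool) : CC := (1 + (-1) ^+ (x + y) * (bigphase lam B b w)^-1) / 2.
pose F w (x : bool) : CC :=
  if w \in A then f w (b w) x * g w x (r w) else (x == b w)%:R * (r w == x)%:R.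
transitivity (\prod_w \sum_x F w x); last first.
  apply: eq_bigr => w _; rewrite big_bool /F; case: (w \in A).
    have : bigphase lam B b w != 0.
      by rewrite /bigphase prodf_seq_neq0; apply/allP => v _; rewrite expf_neq0.
    by rewrite /f /g; case: (b w); case: (r w) => /= nz; field.
  by case: (b w); case: (r w); rewrite /= ?mulr0 ?mul0r ?mulr1 ?addr0 ?add0r.
rewrite bigA_distr_bigA; apply: eq_bigr => s _.
transitivity (amp lam A B b s *
  \prod_w (if w \in A then g w (s w) (r w) else (r w == s w)%:R)); last first.
  by rewrite /amp -big_split; apply: eq_bigr => w _; rewrite /F /=; case: ifP.
have [->|nz] := eqVneq (amp lam A B b s) 0; first by rewrite !mul0r.
congr (_ * _); rewrite run_block; [|exact: amp_clean nz|by move=> *; rewrite invr_neq0].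
apply: eq_bigr => w _; case: ifP => // wA; rewrite /g -(bigphase_amp _ nz).
by rewrite /bigphase -prodfV; under [in RHS]eq_bigr => v _ do rewrite -exprVn.
Qed.

(** With phases 1 or -1 every factor of [amp] is 0 or 1, so a single basis state survives: this is
    HZH = X. *)
Lemma run_block_det lam b (p : 'I_N -> bool) : clean b -> (forall a v, lam a v != 0) ->
  {in A, forall w, bigphase lam B b w = (-1) ^+ p w} ->
  run (flatten (block lam A B)) (ket b) =
  ket [ffun w => if w \in A then b w (+) p w else b w].
Proof.
move=> cb l0 h; rewrite run_block //; apply: funext => r; rewrite ket_prod.
apply: eq_bigr => w _; rewrite ffunE; case: ifP => // wA; rewrite h //.
by case: (b w); case: (r w); case: (p w); rewrite /= ?expr0 ?expr1 ?expr2; field.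
Qed.

Lemma norm_sqrtC (x : CC) : `|x| = 1 -> `|sqrtC x| = 1.
Proof. by move=> x1; rewrite norm_rootC x1 rootC1. Qed.

Lemma norm_prod1 (J : Type) (l : seq J) (f : J -> CC) :
  (forall j, `|f j| = 1) -> `|\prod_(j <- l) f j| = 1.
Proof. by move=> f1; rewrite normr_prod big1. Qed.

Lemma block_wf lam : A != [::] -> B != [::] -> (forall a v, `|lam a v| = 1) ->
  circuit_wf (flatten (block lam A B)).
Proof.
move=> nA nB l1.
have wfH : circuit_wf [seq G1 a hadamard | a <- A].
  by rewrite /circuit_wf all_map; apply/allP => a _; exact: hadamard_unitary.
have wfA : circuit_wf (fanA A B).
  rewrite /circuit_wf all_map; apply/allP => a aA /=; rewrite fanA_ctrl ?AP // andbT.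
  rewrite -size_eq0 size_map size_eq0 nB map_inj_in_uniq // => v v' vB v'B.
  by case/(anc_inj (AP aA) (BP vB) (AP aA) (BP v'B)).
have wfB : circuit_wf (fanB A B).
  rewrite /circuit_wf all_map; apply/allP => v vB /=; rewrite fanB_ctrl ?BP // andbT.
  rewrite -size_eq0 size_map size_eq0 nA map_inj_in_uniq // => a a' aA a'A.
  by case/(anc_inj (AP aA) (BP vB) (AP a'A) (BP vB)).
have wfP (J : Type) (l : seq J) (q : J -> 'I_N) (f : J -> CC) :
    (forall j, `|f j| = 1) -> circuit_wf [seq G1 (q j) (phase (f j)) | j <- l].
  move=> f1; rewrite /circuit_wf all_map; elim: l => //= j l ->.
  by rewrite phase_unitary.
have cat C1 C2 : circuit_wf (C1 ++ C2) = circuit_wf C1 && circuit_wf C2.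
  exact: all_cat.
rewrite /= cats0 !cat wfH wfA wfB !wfP // => *.
- by apply: norm_prod1 => *; exact: norm_sqrtC.
- by apply: norm_prod1 => *; exact: norm_sqrtC.
- by rewrite normfV norm_sqrtC ?invr1.
Qed.

Lemma block_layers lam : all (@layer _) (block lam A B).
Proof.
have l1 (J : Type) (l : seq J) (q : J -> 'I_N) (U : J -> 'M[CC]_2) :
    layer [seq G1 (q j) (U j) | j <- l] = uniq [seq q j | j <- l].
  rewrite /layer -map_comp; congr uniq.
  by elim: l => //= j l ->.
have lanc : uniq [seq anc p.1 p.2 | p <- allpairs pair A B].
  rewrite map_inj_in_uniq; first by rewrite allpairs_uniq // => -[? ?] [? ?].
  move=> [a v] [a' v'] /allpairsP[[? ?] /= [aA vB [-> ->]]].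
  move=> /allpairsP[[? ?] /= [a'A v'B [-> ->]]].
  by case/(anc_inj (AP aA) (BP vB) (AP a'A) (BP v'B)) => -> ->.
have uH : layer [seq G1 a hadamard | a <- A] by rewrite l1 map_id.
have lA : layer (fanA A B).
  apply: layer_fans => // [a aA|a a' aA a'A w /mapP[v vB ->] /mapP[v' v'B]].
    rewrite map_inj_in_uniq // => v v' vB v'B.
    by case/(anc_inj (AP aA) (BP vB) (AP aA) (BP v'B)).
  by case/(anc_inj (AP aA) (BP vB) (AP a'A) (BP v'B)).
have lB : layer (fanB A B).
  apply: layer_fans => // [v vB|v v' vB v'B w /mapP[a aA ->] /mapP[a' a'A]].
    rewrite map_inj_in_uniq // => a a' aA a'A.
    by case/(anc_inj (AP aA) (BP vB) (AP a'A) (BP vB)).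
  by case/(anc_inj (AP aA) (BP vB) (AP a'A) (BP v'B)).
by rewrite /= !l1 !map_id lanc uA uB lA lB.
Qed.

End Block.

(** * Roots of -1 and character sums *)

Definition rt (k : nat) : CC := iter k sqrtC (-1).

Lemma rt_expr k : rt k ^+ (2 ^ k) = -1.
Proof. by elim: k => [|k IH]; rewrite ?expr1 // expnS exprM [rt _]/= sqrtCK. Qed.

Lemma rt_norm k : `|rt k| = 1.
Proof. by elim: k => [|k IH]; rewrite /= ?normrN1 // norm_sqrtC. Qed.

Lemma rt_neq0 k : rt k != 0.
Proof. by rewrite -normr_eq0 rt_norm oner_eq0. Qed.

(** With m = 2^v q and q odd, the power 2^v already gives -1, and the odd power q keeps it. *)
Lemma rt_logn m : (0 < m)%N -> rt (logn 2 m) ^+ m = -1.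
Proof.
move=> m0; have [q q2 {2}->] := pfactor_coprime (isT : prime 2) m0.
by rewrite mulnC exprM rt_expr -signr_odd -coprime2n q2.
Qed.

Definition bit (a k : nat) : bool := odd (a %/ 2 ^ k).

Definition inner (M : nat) (y : nat -> bool) (a : nat) : nat :=
  \sum_(0 <= k < M) (bit a k && y k).

(** Characters factor over the bits of [a]: splitting the range by the top bit yields one new
    factor. *)
Lemma sum_characters (M : nat) (y : nat -> bool) :
  \sum_(0 <= a < 2 ^ M) (-1) ^+ inner M y a =
  \prod_(0 <= k < M) (1 + (-1) ^+ y k) :> int.
Proof.
elim: M => [|M IH].
  by rewrite big_nat1 /inner !big_geq.
rewrite big_nat_recr //= -IH expnS mul2n -addnn.
rewrite (big_cat_nat (n := 2 ^ M)) ?leq_addr //=.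
have -> (F : nat -> int) : \sum_(2 ^ M <= a < 2 ^ M + 2 ^ M) F a =
    \sum_(0 <= a < 2 ^ M) F (a + 2 ^ M)%N.
  by rewrite -{1}[(2 ^ M)%N]add0n big_addn addnK.
rewrite mulrDr mulr1 mulr_suml; congr (_ + _); apply: eq_big_nat => a /= a2.
  by rewrite /inner big_nat_recr //= /bit divn_small // addn0.
(* Adding [2 ^ M] sets bit [M] and leaves the lower bits alone, since [2 ^ (M - k)] is even for k <
   M. *)
rewrite -exprD /inner big_nat_recr //= {2}/bit divnDr // divnn expn_gt0 /=.
rewrite divn_small //=; congr (_ ^+ (_ + _)); apply: eq_big_nat => k /= kM.
rewrite /bit divnDr ?dvdn_exp2l 1?ltnW // -expnB // 1?ltnW // oddD oddX.
by rewrite subn_eq0 leqNgt kM addbF.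
Qed.

(** If some y_k is 1, its factor in [sum_characters] vanishes, so odd and even inner products are
    equally many. *)
Lemma sum_inner (M : nat) (y : nat -> bool) : (0 < M)%N ->
  (\sum_(0 <= a < 2 ^ M) odd (inner M y a) = has y (index_iota 0 M) * 2 ^ M.-1)%N.
Proof.
move=> M0; have [/hasP[k kM yk]|/hasPn y0] := boolP (has y _).
  have : \sum_(0 <= a < 2 ^ M) (-1) ^+ inner M y a = 0 :> int.
    rewrite sum_characters (bigD1_seq k) ?iota_uniq //= yk expr1 subrr mul0r //.
  have -> : \sum_(0 <= a < 2 ^ M) (-1) ^+ inner M y a =
      \sum_(0 <= a < 2 ^ M) (1 - 2 * (odd (inner M y a))%:R) :> int.
    by apply: eq_bigr => a _; rewrite -signr_odd; case: odd.
  rewrite big_split /= sumrN -mulr_sumr -natr_sum sumr_const_nat subn0.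
  move/eqP; rewrite subr_eq0 -natrM eqr_nat mul1n -{1}(prednK M0) expnS.
  by rewrite eqn_pmul2l // => /eqP.
rewrite mul0n big1_seq // => a _; rewrite /inner big1_seq // => k kM.
by rewrite (negPf (y0 k kM)) andbF.
Qed.

(** * The OR circuit: wire layout, correctness, depth and size *)

Section OrCircuit.
Variables n M : nat.

(** [L] counts the wires of x, z, y and t; [L * L] more wires give one ancilla per ordered pair.
    Idle ancillas add nothing to [csize]. *)
Let L := (n + 1 + M + 2 ^ M)%N.
Let m := (M + 2 ^ M + L * L)%N.
Let N := (n + 1 + m)%N.

Let n_lt_N : (n < N)%N.
Proof. rewrite /N; lia. Qed.

Definition wr (k : nat) : 'I_N := insubd (Ordinal n_lt_N) k.

Lemma wrK k : (k < N)%N -> wr k = k :> nat.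
Proof. by move=> kN; rewrite val_insubd kN. Qed.

Definition seg (s k : nat) : seq 'I_N := [seq wr (s + j) | j <- index_iota 0 k].

Lemma size_seg s k : size (seg s k) = k.
Proof. by rewrite size_map size_iota subn0. Qed.

Lemma mem_seg s k w : (s + k <= N)%N -> (w \in seg s k) = (s <= w < s + k)%N.
Proof.
move=> h; apply/mapP/idP => [[j]|/andP[sw wk]].
  by rewrite mem_index_iota => /andP[_ jk] ->; rewrite wrK; lia.
exists (w - s)%N; first by rewrite mem_index_iota; lia.
by apply: ord_inj; rewrite subnKC ?wrK //; lia.
Qed.

Lemma seg_uniq s k : (s + k <= N)%N -> uniq (seg s k).
Proof.
move=> h; rewrite map_inj_in_uniq ?iota_uniq // => i j.
rewrite !mem_index_iota => /andP[_ ik] /andP[_ jk] /(congr1 val).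
by rewrite /= !wrK; lia.
Qed.

Let P (w : 'I_N) := (w < L)%N.
(** Row-major numbering of the pairs, decoded by division by [L]. *)
Definition anc (a v : 'I_N) : 'I_N := wr (L + (a * L + v)).

Lemma ancE a v : P a -> P v -> anc a v = (L + (a * L + v))%N :> nat.
Proof.
rewrite /P => aL vL; rewrite wrK //.
have : (a.+1 * L <= L * L)%N by rewrite leq_mul2r aL orbT.
have NE : N = (L + L * L)%N by rewrite /N /m !addnA.
rewrite [X in (_ < X)%N]NE ltn_add2l; apply: leq_trans.
by rewrite mulSn addnC ltn_add2r.
Qed.

Lemma anc_inj a v a' v' : P a -> P v -> P a' -> P v' ->
  anc a v = anc a' v' -> a = a' /\ v = v'.
Proof.
move=> pa pv pa' pv' /(congr1 val); rewrite /= !ancE // => /addnI e.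
have ea : a = a' :> nat.
  have := congr1 (divn^~ L) e.
  by rewrite !divnMDl ?divn_small ?addn0 //; rewrite /L; lia.
by split; apply: ord_inj => //; move: e; rewrite ea => /addnI.
Qed.

Lemma ancP a v : P a -> P v -> ~~ P (anc a v).
Proof. by move=> pa pv; rewrite /P ancE // -leqNgt leq_addr. Qed.

Definition wX := seg 0 n.
Definition wZ := seg n 1.
Definition wY := seg (n + 1) M.
Definition wT := seg (n + 1 + M) (2 ^ M).

Lemma mem_wX w : (w \in wX) = (w < n)%N.
Proof. by rewrite mem_seg // /N; lia. Qed.
Lemma mem_wZ w : (w \in wZ) = (w == n :> nat).
Proof. by rewrite mem_seg; rewrite /N; lia. Qed.
Lemma mem_wY w : (w \in wY) = (n + 1 <= w < n + 1 + M)%N.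
Proof. by rewrite mem_seg // /N /m; lia. Qed.
Lemma mem_wT w : (w \in wT) = (n + 1 + M <= w < L)%N.
Proof. by rewrite mem_seg // /N /m; lia. Qed.

(** The subtracted offset is the start of the y segment, leaving the index k of y_k; in [lamT]
    likewise for the index of t_a. *)
Definition lamY (a v : 'I_N) : CC := rt (a - (n + 1)).
Definition lamT (a v : 'I_N) : CC := (-1) ^+ bit (a - (n + 1 + M)) (v - (n + 1)).
Definition lamZ (a v : 'I_N) : CC := rt M.-1.

Definition mid_circuit : seq (circuit N) :=
  block anc lamT wT wY ++ block anc lamZ wZ wT ++ block anc lamT wT wY.

Definition or_circuit : seq (circuit N) :=
  block anc lamY wY wX ++ mid_circuit ++
  block anc (fun a v => (lamY a v)^-1) wY wX.

Lemma lamY_neq0 a v : lamY a v != 0. Proof. exact: rt_neq0. Qed.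
Lemma lamT_neq0 a v : lamT a v != 0. Proof. by rewrite signr_eq0. Qed.
Lemma lamZ_neq0 a v : lamZ a v != 0. Proof. exact: rt_neq0. Qed.

Lemma wX_P : {in wX, forall w, P w}.
Proof. by move=> w; rewrite mem_wX /P /L; lia. Qed.
Lemma wZ_P : {in wZ, forall w, P w}.
Proof. by move=> w; rewrite mem_wZ /P /L; lia. Qed.
Lemma wY_P : {in wY, forall w, P w}.
Proof. by move=> w; rewrite mem_wY /P /L; lia. Qed.
Lemma wT_P : {in wT, forall w, P w}.
Proof. by move=> w; rewrite mem_wT /P /L; lia. Qed.
Lemma wX_uniq : uniq wX. Proof. by apply: seg_uniq; rewrite /N; lia. Qed.
Lemma wZ_uniq : uniq wZ. Proof. by apply: seg_uniq; rewrite /N /m; lia. Qed.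
Lemma wY_uniq : uniq wY. Proof. by apply: seg_uniq; rewrite /N /m; lia. Qed.
Lemma wT_uniq : uniq wT. Proof. by apply: seg_uniq; rewrite /N /m; lia. Qed.
Lemma wYX : {in wY, forall w, w \notin wX}.
Proof. by move=> w; rewrite mem_wY mem_wX; lia. Qed.
Lemma wTY : {in wT, forall w, w \notin wY}.
Proof. by move=> w; rewrite mem_wT mem_wY; lia. Qed.
Lemma wZT : {in wZ, forall w, w \notin wT}.
Proof. by move=> w; rewrite mem_wZ mem_wT; lia. Qed.

Definition flipZ (e : bool) (r : basis N) : basis N :=
  [ffun w => if w \in wZ then r w (+) e else r w].

Definition par (r : basis N) (w : 'I_N) : bool :=
  odd (inner M (fun k => r (wr (n + 1 + k))) (w - (n + 1 + M))).

Lemma bigphaseT r w : w \in wT -> bigphase lamT wY r w = (-1) ^+ par r w.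
Proof.
move=> wwT; rewrite /bigphase big_map /par signr_odd /inner expr_sum.
rewrite big_seq [RHS]big_seq; apply: eq_bigr => k; rewrite mem_index_iota => kM.
rewrite /lamT wrK; last by rewrite /N /m; lia.
by rewrite addKn -exprM; case: bit; case: (r _).
Qed.

Hypotheses (n_gt0 : (0 < n)%N) (M_gt0 : (0 < M)%N) (nM : (n < 2 ^ M)%N).

(** The number of t wires set to 1 is 0 or [2 ^ M.-1], and [rt M.-1] to the latter power is -1. *)
Lemma bigphaseZ (r : basis N) : {in wT, forall w, r w = par r w} ->
  {in wZ, forall w, bigphase lamZ wT r w = (-1) ^+ has r wY}.
Proof.
move=> rT w _; rewrite /bigphase big_map prodrXr.
set y := fun k => r (wr (n + 1 + k)).
transitivity (rt M.-1 ^+ (\sum_(0 <= a < 2 ^ M) odd (inner M y a))).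
  congr (_ ^+ _); apply: eq_big_nat => a aM.
  rewrite rT; last by rewrite mem_wT wrK /N /m /L; lia.
  by rewrite /par wrK ?addKn // /N /m; lia.
by rewrite sum_inner // has_map mulnC exprM rt_expr.
Qed.

Lemma par_eq (r s : basis N) w : {in wY, r =1 s} -> par r w = par s w.
Proof.
move=> e; rewrite /par /inner; congr odd; apply: eq_big_nat => k kM.
by rewrite e // mem_wY wrK /N /m; lia.
Qed.

(** The parities depend only on y, which all three blocks preserve, so the last block adds the same
    parities to t and clears it. *)
Lemma run_mid (r : basis N) : clean P r -> {in wT, forall w, r w = false} ->
  run (flatten mid_circuit) (ket r) = ket (flipZ (has r wY) r).
Proof.
move=> cr rT; rewrite /mid_circuit 2!flatten_cat 2!run_cat.
rewrite (run_block_det anc_inj ancP wT_uniq wY_uniq wT_P wY_P wTY cr lamT_neq0 (@bigphaseT r)).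
set r1 := finfun _.
have r1Y : {in wY, r1 =1 r}.
  by move=> w wy; rewrite ffunE; case: ifP => // /wTY; rewrite wy.
have cr1 : clean P r1.
  move=> w nP; rewrite ffunE cr //; case: ifP => // /wT_P; by rewrite (negPf nP).
have r1T : {in wT, forall w, r1 w = par r1 w}.
  by move=> w wt; rewrite (par_eq _ r1Y) ffunE wt rT.
rewrite (run_block_det anc_inj ancP wZ_uniq wT_uniq wZ_P wT_P wZT cr1 lamZ_neq0 (bigphaseZ r1T)).
rewrite (eq_in_has r1Y); set r2 := finfun _.
have cr2 : clean P r2.
  move=> w nP; rewrite ffunE cr1 //; case: ifP => // /wZ_P; by rewrite (negPf nP).
rewrite (run_block_det anc_inj ancP wT_uniq wY_uniq wT_P wY_P wTY cr2 lamT_neq0 (@bigphaseT r2)).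
have r2Y : {in wY, r2 =1 r}.
  move=> w wy; rewrite ffunE r1Y //; case: ifP => //.
  by move: wy; rewrite mem_wY mem_wZ; lia.
congr ket; apply/ffunP => w; rewrite !ffunE (par_eq _ r2Y).
case: (boolP (w \in wT)) => // wt.
by rewrite (negPf (contraL (@wZT w) wt)) -addbA addbb addbF.
Qed.

Lemma enc_clean (x : n.-tuple bool) z : clean P (enc m x z).
Proof.
move=> w; rewrite /P -leqNgt ffunE => Lw.
have nw : (n < w)%N by apply: leq_trans Lw; rewrite /L; lia.
by rewrite ltnNge (ltnW nw) (gtn_eqF nw).
Qed.

Lemma enc_flip (x : n.-tuple bool) z e : flipZ e (enc m x z) = enc m x (z (+) e).
Proof.
apply/ffunP => w; rewrite !ffunE mem_wZ; case: (eqVneq (w : nat) n) => [->|//].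
by rewrite ltnn.
Qed.

Lemma bigphaseY (x : n.-tuple bool) z w :
  bigphase lamY wX (enc m x z) w = rt (w - (n + 1)) ^+ count id x.
Proof.
rewrite /bigphase big_map prodrXr; congr (_ ^+ _).
rewrite -sum1_count [RHS]big_mkcond (big_nth false) size_tuple.
apply: eq_big_nat => j /= jn; rewrite ffunE wrK ?jn; last by rewrite /N; lia.
by case: nth.
Qed.

(** Every factor of a nonzero amplitude is nonzero. For x = 0 all phases are 1, which forces y = 0;
    otherwise the phase of wire y_k, with k the 2-adic valuation of the weight, is -1 and forces y_k
    = 1. *)
Lemma amp_ORn (x : n.-tuple bool) z r :
  amp lamY wY wX (enc m x z) r != 0 -> has r wY = ORn x.
Proof.
move=> nz.
have factor w : w \in wY -> 1 + (-1) ^+ r w * rt (w - (n + 1)) ^+ count id x != 0.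
  move=> wy; apply: contra nz => /eqP e; rewrite /amp (bigD1 w) //= wy bigphaseY.
  have -> : enc m x z w = false.
    move: wy; rewrite mem_wY => /andP[nw _]; rewrite addn1 in nw.
    by rewrite ffunE ltnNge (ltnW nw) (gtn_eqF nw).
  by rewrite e mul0r mul0r.
rewrite /ORn [has id x]has_count; case: posnP => c0.
  apply/negbTE/hasPn => w /factor; rewrite c0 expr0 mulr1.
  by case: (r w); rewrite // expr1 subrr eqxx.
apply/hasP; set k := logn 2 (count id x).
(* [2 ^ k] divides the weight of x, which is at most [n], and n < 2 ^ M. *)
have kM : (k < M)%N.
  rewrite -(ltn_exp2l _ _ (isT : 1 < 2)%N); apply: leq_ltn_trans nM.
  apply: leq_trans (dvdn_leq c0 (pfactor_dvdnn 2 _)) _.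
  by rewrite -[X in (_ <= X)%N](size_tuple x) count_size.
have wk : wr (n + 1 + k) = (n + 1 + k)%N :> nat by rewrite wrK /N /m; lia.
have wy : wr (n + 1 + k) \in wY by rewrite mem_wY wk; lia.
exists (wr (n + 1 + k)) => //; have := factor _ wy.
by rewrite wk addKn rt_logn //; case: (r _); rewrite // expr0 mul1r subrr eqxx.
Qed.

(** The middle circuit flips z by the same bit in every branch, so the result is the superposition
    made from the flipped input, which the last block uncomputes. *)
Lemma or_circuit_correct : implements_OR (flatten or_circuit : circuit (n + 1 + m)).
Proof.
move=> x z; rewrite /or_circuit 2!flatten_cat 2!run_cat.
have yx := run_block anc_inj ancP wY_uniq wX_uniq wY_P wX_P wYX _ lamY_neq0.
rewrite yx; last exact: enc_clean.
have -> : run (flatten mid_circuit) (amp lamY wY wX (enc m x z)) =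
    amp lamY wY wX (enc m x (z (+) ORn x)); last first.
  exact: (run_blockV anc_inj ancP wY_uniq wX_uniq wY_P wX_P wYX (enc_clean _ _) lamY_neq0).
set e := ORn x; rewrite run_ketE; apply: funext => r.
have flipK s : flipZ e (flipZ e s) = s.
  by apply/ffunP => w; rewrite !ffunE; case: (w \in wZ) => //; rewrite -addbA addbb addbF.
(* As [flipZ e] is an involution, only the branch [flipZ e r] contributes at [r]. *)
transitivity (amp lamY wY wX (enc m x z) (flipZ e r)).
  rewrite [RHS](congr1 (@^~ _) (ket_expand _)); apply: eq_bigr => s _.
  have [->|nz] := eqVneq (amp lamY wY wX (enc m x z) s) 0; first by rewrite !mul0r.
  rewrite run_mid ?(amp_ORn nz).
  - by rewrite /ket; congr (_ * (nat_of_bool _)%:R); apply/eqP/eqP => [->|<-]; rewrite flipK.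
  - exact: (amp_clean wY_P (enc_clean x z) nz).
  - move=> w wt; rewrite (amp_supp (wTY wt) nz) ffunE.
    move: wt; rewrite mem_wT => /andP[tw _].
    have nw : (n < w)%N by apply: leq_trans tw; lia.
    by rewrite ltnNge (ltnW nw) (gtn_eqF nw).
rewrite /amp; apply: eq_bigr => w _; rewrite !bigphaseY -enc_flip.
rewrite [flipZ _ _ w]ffunE [flipZ _ (enc _ _ _) w]ffunE.
case: (boolP (w \in wZ)) => // wz.
have -> : w \in wY = false by move: wz; rewrite mem_wY mem_wZ; lia.
by rewrite /e; case: (r w); case: (ORn x); case: (enc _ _ _ w).
Qed.

Lemma or_circuit_wf : circuit_wf (flatten or_circuit).
Proof.
have nilF s k : (0 < k)%N -> seg s k != [::] by rewrite -size_eq0 size_seg -lt0n.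
have e2 : (0 < 2 ^ M)%N by rewrite expn_gt0.
have bY := block_wf anc_inj ancP wY_uniq wX_uniq wY_P wX_P
  (nilF _ _ M_gt0) (nilF _ _ n_gt0).
have bT := block_wf anc_inj ancP wT_uniq wY_uniq wT_P wY_P
  (nilF _ _ e2) (nilF _ _ M_gt0).
have bZ := block_wf anc_inj ancP wZ_uniq wT_uniq wZ_P wT_P
  (nilF _ _ (ltn0Sn 0)) (nilF _ _ e2).
rewrite /or_circuit /mid_circuit 4!flatten_cat /circuit_wf 4!all_cat.
apply/and3P; split; [apply: bY|apply/and3P; split; [apply: bT|apply: bZ|apply: bT]|apply: bY] => *.
- exact: rt_norm.
- by rewrite /lamT normrX normrN1 expr1n.
- exact: rt_norm.
- by rewrite /lamT normrX normrN1 expr1n.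
- by rewrite normfV rt_norm invr1.
Qed.

(** Five blocks of nine layers each: seven for D and two of Hadamard gates. *)
Lemma or_circuit_depth : (cdepth (flatten or_circuit) <= 45)%N.
Proof.
have lb := block_layers anc_inj ancP.
apply: leq_trans (depth_layers _) _; last by [].
rewrite /or_circuit /mid_circuit 4!all_cat.
by rewrite !lb ?wX_uniq ?wY_uniq ?wZ_uniq ?wT_uniq //;
  solve [exact: wX_P|exact: wY_P|exact: wZ_P|exact: wT_P].
Qed.

Lemma or_circuit_size :
  (csize (flatten or_circuit) <= 26 * (n * M + 2 ^ M * M + 2 ^ M))%N.
Proof.
rewrite /or_circuit /mid_circuit 4!flatten_cat 4!csize_cat !block_size /wX /wY /wZ /wT !size_seg.
(* The two t blocks contribute 10 to the coefficient of [2 ^ M * M]; the terms linear in [M] total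
   [16 * M], which accounts for 26. *)
nia.
Qed.

End OrCircuit.

(** * Choice of M and the asymptotic size bound *)

Lemma trunc_log_le_log2 (n : nat) : (0 < n)%N -> (trunc_log 2 n)%:R <= log2 n%:R.
Proof.
move=> n0; rewrite /log2 ler_pdivlMr ?ln_gt0 ?ltr1n //.
rewrite mulr_natl -lnXn ?ltr0n // ler_ln ?posrE ?exprn_gt0 ?ltr0n //.
by rewrite -natrX ler_nat trunc_logP.
Qed.

Theorem theorem1 :
  exists (d : nat) (c : RR) (n0 : nat),
    forall n : nat, (1 <= n)%N ->
      exists (m : nat) (C : circuit (n + 1 + m)),
        [/\ circuit_wf C,
            implements_OR C,
            (cdepth C <= d)%N
          & (n0 <= n)%N -> (csize C)%:R <= c * n%:R * log2 n%:R].
Proof.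
(* The size bound starts at n = 2 because log2 1 = 0. For M = t + 1 one has 2^M <= 2n and M <= 2t,
   so nM + 2^M M + 2^M <= 8nt, and 26 times 8 is below 260. *)
exists 45%N, 260%:R, 2%N => n n0; pose t := trunc_log 2 n.
have nM : (n < 2 ^ t.+1)%N by apply: trunc_log_ltn.
exists _, (flatten (or_circuit n t.+1)); split.
- exact: or_circuit_wf.
- exact: or_circuit_correct.
- exact: or_circuit_depth.
move=> n2; apply: Order.POrderTheory.le_trans (_ : (260 * (n * t))%:R <= _).
  rewrite ler_nat; apply: leq_trans (or_circuit_size _ _ _) _ => //.
  have t0 : (0 < t)%N by rewrite trunc_log_gt0.
  have : (2 ^ t <= n)%N by exact: trunc_logP.
  rewrite expnS; move: (2 ^ t)%N t0 => p; nia.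
by rewrite !natrM -!mulrA !ler_wpM2l ?ler0n ?trunc_log_le_log2.
Qed.
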